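(* Let $\mathcal T$ be a minimally complete abstract Newton tree at infinity. For all $(u,e)\in P(\mathcal T)$, the numbers $p(u,e)$, $p'(u,e)$ and $N_u$ belong to $c(u,e)\,\mathbb Z$.
   Context: **Decorated rooted trees.** A rooted tree is a finite tree with set of cells $X_0$, edges (2-element subsets of $X_0$) and a root $v_0\in X_0$; $\delta_x$ is the valency of $x$, and $\gamma_{x,y}$ the unique path from $x$ to $y$. Arrows: $\mathcal A=\{x:\delta_x=1\}\setminus\{v_0\}$; vertices: $\mathcal V=X_0\setminus\mathcal A$. For distinct $x,y$, $x<y$ means that $x$ is on $\gamma_{v_0,y}$. In a decorated rooted tree, each arrow is decorated by $(0)$ or $(1)$ ($\mathcal A_0$ = set of arrows decorated by $(0)$), and each pair $(e,x)$ with $e$ an edge and $x\in e$ carries an integer $q(e,x)$ (decoration of $e$ near $x$). $Q(e,x)=\prod q(e',x)$ over edges $e'\ne e$ incident to $x$ (empty products are $1$). For an edge $e=\{x,y\}$ with $x,y\in\mathcal V$, $\det(e)=q(e,x)q(e,y)-Q(e,x)Q(e,y)$. A dead end is an edge incident to an element of $\mathcal A_0$. **Abstract Newton tree at infinity**: a decorated rooted tree such that (1) for each $v\in\mathcal V$ some $\alpha\in\mathcal A\setminus\mathcal A_0$ satisfies $\alpha>v$; (2) at most one dead end is incident to a given vertex; (3) $q(e,v_0)=1$ for all edges $e$ incident to $v_0$; (4) $q(e,\alpha)=1$ for every edge $e$ incident to an arrow $\alpha$; (5) for $v\in\mathcal V$ and distinct edges $e,e'$ incident to $v$, $q(e,v)$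 and $q(e',v)$ are coprime; with $E_v^+$ the set of edges $\{v,x\}$ with $v<x$, $q(e,v)\ge1$ for all $e\in E_v^+$, at most one $e\in E_v^+$ has $q(e,v)>1$, and if a dead end $\epsilon$ is incident to $v$ then $q(\epsilon,v)=\max_{e\in E_v^+}q(e,v)$; (6) $\det(e)<0$ for every edge $e$ joining two vertices. For $v\in\mathcal V$, $\alpha\in\mathcal A\setminus\mathcal A_0$: $x_{v,\alpha}$ is the product of $q(\epsilon,u)$ over all edges $\epsilon$ not in $\gamma_{v,\alpha}$ but incident to a cell $u$ of $\gamma_{v,\alpha}$; $\hat x_{v,\alpha}$ is the same product restricted to those edges $\epsilon$ that are not incident to $v$; $N_v=\sum_{\alpha\in\mathcal A\setminus\mathcal A_0}x_{v,\alpha}$. A dicritical vertex is a vertex with $N_v=0$. The tree is **minimally complete** if (i) $N_v\ge0$ for all $v\in\mathcal V$ and each arrow decorated by $(1)$ is adjacent to a dicritical vertex; (ii) a dead end is incident to each dicritical vertex; (iii) if a dead end $e$ incident to a vertex $v$ has $q(e,v)=1$ then $v$ is dicritical; (iv) every vertex $\ne v_0$ has valency $\ne2$. **Notation.** $\mathcal N=\{v\in\mathcal V:N_v>0\}$ (a subtree containing $v_0$; an edge of $\mathcal N$ is an edge with both endpoints in $\mathcal N$). $\mathcal D_v$: set of dicritical vertices adjacent to $v$. Degree $d_u$ of a dicritical $u$: number of $(1)$-arrows adjacent to $u$. $v\in\mathcal N$ is a node if $\mathcal D_v\neq\emptyset$. $a_v=q(e,v)$ if a dead end $e$ is incident to $v$,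 $a_v=1$ otherwise. $\epsilon(v)$: number of elements of $\mathcal N$ adjacent to $v$. $d(v)=N_v$ if $v\in\mathcal N$ is not a node, $d(v)=\gcd\{d_u:u\in\mathcal D_v\}$ if $v$ is a node. $P(\mathcal T)$ is the set of pairs $(u,e)$ with $u\in\mathcal N$ and $e$ an edge of $\mathcal N$ incident to $u$. For $(u,e)\in P(\mathcal T)$ with $e=\{u,u_0\}$, let $A(u,e)=\{\alpha\in\mathcal A\setminus\mathcal A_0: e\text{ is in }\gamma_{u,\alpha}\}$, $A'(u,e)=(\mathcal A\setminus\mathcal A_0)\setminus A(u,e)$, $p(u,e)=\sum_{\alpha\in A(u,e)}\hat x_{u,\alpha}$ and $p'(u,e)=\sum_{\alpha\in A'(u,e)}\hat x_{u_0,\alpha}$. **Characteristic numbers** $c(u,e)\in\mathbb Q$ are defined recursively: let $(u,e)\in P(\mathcal T)$, $e=\{u,u_0\}$. If $\epsilon(u_0)=1$, $c(u,e)=d(u_0)/a_{u_0}$. Otherwise, with $u,u_1,\dots,u_n$ the distinct elements of $\mathcal N$ adjacent to $u_0$ and $e_i=\{u_0,u_i\}$, $c(u,e)=\gcd(d(u_0),c(u_0,e_1),\dots,c(u_0,e_n))/a_{u_0}$, where the gcd of rational numbers $x_1,\dots,x_m$ is the unique $\xi\ge0$ with $\xi\mathbb Z=x_1\mathbb Z+\dots+x_m\mathbb Z$. *)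

(* Defs.v *)
From HB Require Import structures.
From mathcomp Require Import all_boot all_order all_algebra ring.

Set Implicit Arguments.
Unset Strict Implicit.
Unset Printing Implicit Defensive.

Import Order.TTheory GRing.Theory Num.Theory.
Local Open Scope ring_scope.

(* The gcd of rational numbers; [rat_gcd_ge0] and [rat_gcd_span] show that
   [rat_gcd s] is the nonnegative generator of the subgroup spanned by [s]. *)

Definition rat_gcd2 (x y : rat) : rat :=
  (gcdz (numq x * denq y) (numq y * denq x))%:~R / (denq x * denq y)%:~R.

Definition rat_gcd (s : seq rat) : rat := foldr rat_gcd2 0 s.

Definition in_multiples (c x : rat) : Prop := exists k : int, x = c * k%:~R.

Lemma rat_gcd_ge0 s : 0 <= rat_gcd s.
Proof.
case: s => [|x s] //=; rewrite /rat_gcd2.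
apply: divr_ge0; rewrite ler0z //.
by apply: mulr_ge0; apply: denq_ge0.
Qed.

Lemma rat_gcd2_span (x y z : rat) :
  in_multiples (rat_gcd2 x y) z <->
  exists a b : int, z = x * a%:~R + y * b%:~R.
Proof.
rewrite /in_multiples /rat_gcd2.
set m := numq x * denq y; set n := numq y * denq x.
have dx0 : (denq x)%:~R != 0 :> rat by rewrite intr_eq0 denq_neq0.
have dy0 : (denq y)%:~R != 0 :> rat by rewrite intr_eq0 denq_neq0.
have xE : x = m%:~R / (denq x * denq y)%:~R.
  rewrite /m !rmorphM /= invfM mulrACA divff // mulr1.
  by rewrite [LHS](esym (divq_num_den x)).
have yE : y = n%:~R / (denq x * denq y)%:~R.
  rewrite /n !rmorphM /= [(denq x)%:~R * (denq y)%:~R]mulrC invfM.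
  by rewrite mulrACA divff // mulr1 [LHS](esym (divq_num_den y)).
set D := (denq x * denq y)%:~R in xE yE *.
split=> [[k ->]|[a [b ->]]].
  have [u [v uvE]] := Bezoutz m n.
  exists (u * k), (v * k); rewrite xE yE -uvE.
  by rewrite !rmorphD !rmorphM /=; ring.
have /dvdzP[m' mE] := dvdz_gcdl m n.
have /dvdzP[n' nE] := dvdz_gcdr m n.
exists (m' * a + n' * b); rewrite xE yE; move: (gcdz m n) mE nE => g -> ->.
by rewrite !rmorphD !rmorphM /=; ring.
Qed.

Lemma rat_gcd_span (s : seq rat) (z : rat) :
  in_multiples (rat_gcd s) z <->
  exists a : nat -> int, z = \sum_(i < size s) s`_i * (a i)%:~R.
Proof.
elim: s z => [|x s IHs] z.
  split=> [[k ->]|[a ->]].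
    by exists (fun=> 0); rewrite big_ord0 mul0r.
  by exists 0; rewrite big_ord0 mul0r.
rewrite /= rat_gcd2_span; split=> [[a [b zE]]|[a zE]].
  have [f fE] : exists f : nat -> int,
      rat_gcd s * b%:~R = \sum_(i < size s) s`_i * (f i)%:~R.
    by apply/IHs; exists b.
  exists (fun i => if i is i'.+1 then f i' else a).
  by rewrite big_ord_recl zE fE.
have /IHs[b bE] : exists f : nat -> int,
    \sum_(i < size s) s`_i * (a i.+1)%:~R = \sum_(i < size s) s`_i * (f i)%:~R.
  by exists (fun i => a i.+1).
by exists (a 0%N), b; rewrite zE big_ord_recl -bE.
Qed.

(* [simple_path E x y p]: [x :: p] lists the cells of a path from x to y. *)
Definition simple_path (X : finType) (E : {set {set X}}) (x y : X) (p : seq X) :=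
  [&& path (fun a b => [set a; b] \in E) x p, uniq (x :: p) & last x p == y].

(* [q e x] is the decoration of e near x, and [dec1 x] says that the arrow x is
   decorated by (1), otherwise by (0). The value of [q e x] is irrelevant unless
   e is an edge containing x, and that of [dec1 x] unless x is an arrow. *)
Record decorated_tree := DecoratedTree {
  cell :> finType;
  edges : {set {set cell}};
  root : cell;
  q : {set cell} -> cell -> int;
  dec1 : pred cell;
  edge_card : forall e, e \in edges -> #|e| = 2%N;
  tree_path : forall x y, exists! p, simple_path edges x y p
}.

Section DecoratedTree.

Variable T : decorated_tree.
Implicit Types (x y u v w : T) (e : {set T}).

Definition adj x y := [set x; y] \in edges T.

Definition inc_edges x : {set {set T}} := [set e in edges T | x \in e].

Definition valency x := #|inc_edges x|.

Definition arrows : {set T} := [set x | valency x == 1%N] :\ root T.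
Definition vertices : {set T} := ~: arrows.
Definition arrows0 : {set T} := [set x in arrows | ~~ dec1 x].
Definition arrows1 : {set T} := arrows :\: arrows0.

Lemma simple_path_ex x y : exists p, simple_path (edges T) x y p.
Proof. by have [p [sp _]] := tree_path x y; exists p. Qed.

Definition gamma_tail x y : seq T := xchoose (simple_path_ex x y).

Definition gamma x y : seq T := x :: gamma_tail x y.
Definition gamma_edges x y : seq {set T} :=
  pairmap (fun a b => [set a; b]) x (gamma_tail x y).

Definition tree_lt x y := (x != y) && (x \in gamma (root T) y).

Definition bigQ e x : int := \prod_(e' in inc_edges x | e' != e) q e' x.

(* Determinant of the edge [set x; y]. *)
Definition edge_det x y : int :=
  let e := [set x; y] in q e x * q e y - bigQ e x * bigQ e y.

Definition dead_ends : {set {set T}} :=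
  [set e in edges T | [exists x in arrows0, x \in e]].

Definition dead_ends_at x : {set {set T}} := [set e in dead_ends | x \in e].

(* E_v^+ *)
Definition up_edges v : {set {set T}} :=
  [set e in edges T | [exists x, (e == [set v; x]) && tree_lt v x]].

Record newton_tree : Prop := NewtonTree {
  newton_arrow : forall v, v \in vertices ->
    exists2 a, a \in arrows1 & tree_lt v a;
  newton_dead_end : forall v, v \in vertices -> (#|dead_ends_at v| <= 1)%N;
  newton_root : forall e, e \in inc_edges (root T) -> q e (root T) = 1;
  newton_arrow_dec : forall a e, a \in arrows -> e \in inc_edges a -> q e a = 1;
  newton_coprime : forall v e e', v \in vertices ->
    e \in inc_edges v -> e' \in inc_edges v -> e != e' ->
    coprimez (q e v) (q e' v);
  newton_up_ge1 : forall v e, v \in vertices -> e \in up_edges v -> 1 <= q e v;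
  newton_up_gt1 : forall v, v \in vertices ->
    (#|[set e in up_edges v | (1 < q e v)%R]| <= 1)%N;
  newton_dead_end_max : forall v (eps : {set T}), v \in vertices -> eps \in dead_ends_at v ->
    (exists2 e, e \in up_edges v & q eps v = q e v) /\
    (forall e, e \in up_edges v -> q e v <= q eps v);
  newton_det : forall x y, x \in vertices -> y \in vertices -> adj x y ->
    edge_det x y < 0
}.

(* An edge outside [gamma v a] meets it in at most one cell, so the product over
   edges is a product over pairs (cell of the path, incident edge). *)
Definition xnum v a : int :=
  \prod_(u <- gamma v a)
    \prod_(e in inc_edges u | e \notin gamma_edges v a) q e u.

Definition xhat v a : int :=
  \prod_(u <- gamma v a)
    \prod_(e in inc_edges u | (e \notin gamma_edges v a) && (v \notin e)) q e u.

Definition mult v : int := \sum_(a in arrows1) xnum v a.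

Definition dicriticals : {set T} := [set v in vertices | mult v == 0].

Record minimally_complete : Prop := MinimallyComplete {
  mc_mult_ge0 : forall v, v \in vertices -> 0 <= mult v;
  mc_arrow1 : forall a, a \in arrows1 -> exists2 v, v \in dicriticals & adj v a;
  mc_dicritical : forall v, v \in dicriticals ->
    exists e, e \in dead_ends_at v;
  mc_dead_end : forall v e, v \in vertices -> e \in dead_ends_at v ->
    q e v = 1 -> v \in dicriticals;
  mc_valency : forall v, v \in vertices -> v != root T -> valency v <> 2%N
}.

(* The subtree written N (calligraphic), and its edges. *)
Definition subN : {set T} := [set v in vertices | 0 < mult v].
Definition subN_edges : {set {set T}} := [set e in edges T | e \subset subN].

Definition dic_adj v : {set T} := [set u in dicriticals | adj v u].

Definition degree u : nat := #|[set a in arrows1 | adj u a]|.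

Definition is_node v := (v \in subN) && (dic_adj v != set0).

(* The dead end at a vertex of a Newton tree, if any, is unique. *)
Definition dead_dec v : int :=
  if [pick e in dead_ends_at v] is Some e then q e v else 1.

Definition subN_nbrs v : {set T} := [set u in subN | adj v u].

Definition epsilon v : nat := #|subN_nbrs v|.

Definition dnum v : int :=
  if is_node v then (\big[gcdn/0%N]_(u in dic_adj v) degree u)%:Z else mult v.

Definition pairsP : {set T * {set T}} :=
  [set ue | [&& ue.1 \in subN, ue.2 \in subN_edges & ue.1 \in ue.2]].

(* The endpoint of e other than u; see [other_endE]. *)
Definition other_end u e : T := odflt u [pick x in e :\ u].

Definition arrowsA u e : {set T} := [set a in arrows1 | e \in gamma_edges u a].
Definition arrowsA' u e : {set T} := arrows1 :\: arrowsA u e.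

Definition pnum u e : int := \sum_(a in arrowsA u e) xhat u a.
Definition pnum' u e : int := \sum_(a in arrowsA' u e) xhat (other_end u e) a.

(* The recursion defining c(u,e) goes away from u and so ends after fewer than
   #|T| steps; [charnumE] is the recursive equation. *)
Fixpoint charnum_rec (n : nat) u e : rat :=
  if n is n'.+1 then
    let u0 := other_end u e in
    if epsilon u0 == 1%N then (dnum u0)%:~R / (dead_dec u0)%:~R
    else rat_gcd ((dnum u0)%:~R ::
           [seq charnum_rec n' u0 [set u0; w] | w <- enum (subN_nbrs u0 :\ u)])
         / (dead_dec u0)%:~R
  else 0.

Definition charnum u e : rat := charnum_rec #|T| u e.

Lemma adj_sym x y : adj x y = adj y x.
Proof. by rewrite /adj setUC. Qed.

Lemma adj_neq x y : adj x y -> x != y.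
Proof. by move/edge_card; rewrite cards2; case: eqVneq. Qed.

Lemma other_endE u w : u != w -> other_end u [set u; w] = w.
Proof.
move=> nuw; rewrite /other_end; case: pickP => [x | /(_ w)] /=.
  by rewrite !inE => /andP[/negPf-> /= /eqP].
by rewrite !inE eq_sym nuw eqxx orbT.
Qed.

Lemma pairsP_other_end u e : (u, e) \in pairsP ->
  e = [set u; other_end u e] /\ other_end u e \in subN_nbrs u.
Proof.
rewrite inE => /and3P[/= _ eN ue]; move: eN; rewrite inE => /andP[eE /subsetP eN].
have /eqP/cards2P[x [y [nxy exy]]] := edge_card eE.
have [w nuw ew] : exists2 w, u != w & e = [set u; w].
  move: ue; rewrite exy in_set2 => /orP[]/eqP->; first by exists y.
  by exists x; rewrite 1?eq_sym // setUC.
rewrite ew other_endE //; split=> //.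
by rewrite inE /adj -ew eE andbT; apply: eN; rewrite ew set22.
Qed.

Lemma charnum_rec_stable n u u0 : adj u u0 ->
  (forall p, path adj u0 p -> uniq [:: u, u0 & p] -> (size p < n)%N) ->
  charnum_rec n u [set u; u0] = charnum_rec n.+1 u [set u; u0].
Proof.
elim: n u u0 => [|n IHn] u u0 uu0 size_p.
  by have := size_p [::] isT; rewrite /= inE andbT adj_neq // => /(_ isT).
rewrite [LHS]/= [RHS]/= other_endE ?adj_neq //.
case: ifP => // _; congr (rat_gcd (_ :: _) / _).
apply/eq_in_map => w; rewrite mem_enum !inE => /and3P[nwu _ u0w].
apply: IHn => // p wp up; apply: (size_p (w :: p)); first by rewrite /= u0w.
rewrite cons_uniq up andbT inE (negPf (adj_neq uu0)) /=.
apply/negP => uwp.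
have [p1 p1P]: exists p1, simple_path (edges T) u0 u (w :: p1).
  move: uwp; rewrite inE eq_sym (negPf nwu) /= => up'.
  case/path.splitP: up' wp up => p1 p2; rewrite cat_path -!cat_cons cat_uniq.
  move=> /andP[wp1 _] /and3P[uq _ _]; exists (rcons p1 u).
  apply/and3P; split; [by apply/andP | exact: uq | by rewrite /= last_rcons].
have p2P : simple_path (edges T) u0 u [:: u].
  rewrite /simple_path /= eqxx !andbT inE eq_sym (adj_neq uu0) andbT.
  by rewrite -/(adj u0 u) adj_sym.
have [p' [_ uniqp]] := tree_path u0 u.
have := uniqp _ p1P; rewrite (uniqp _ p2P) => -[uw _].
by rewrite uw eqxx in nwu.
Qed.

Lemma charnumE u e : (u, e) \in pairsP ->
  let u0 := other_end u e in
  charnum u e =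
    if epsilon u0 == 1%N then (dnum u0)%:~R / (dead_dec u0)%:~R
    else rat_gcd ((dnum u0)%:~R ::
           [seq charnum u0 [set u0; w] | w <- enum (subN_nbrs u0 :\ u)])
         / (dead_dec u0)%:~R.
Proof.
move=> /pairsP_other_end[eE]; rewrite inE => /andP[_ uu0] u0.
rewrite /= /charnum {1}eE charnum_rec_stable -?eE //.
move=> p _ uq; have := card_uniqP uq => /= sz.
by have := max_card (mem [:: u, other_end u e & p]); rewrite sz => /ltnW.
Qed.

End DecoratedTree.

(* Main.v *)
Require Import Defs.
From mathcomp Require Import all_boot all_order all_algebra ring.

Set Implicit Arguments.
Unset Strict Implicit.
Unset Printing Implicit Defensive.

Import Order.TTheory GRing.Theory Num.Theory.
Local Open Scope ring_scope.

(** The tree enters only through the numbers p(x,e) for the two orientations of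
    each edge. Write p(x,y) for p(x,{x,y}) and q(x,y) for the decoration of
    {x,y} near x; then p'(x,{x,y}) = p(y,x). Sorting the arrows by the edge
    through which the path from y leaves y gives the two local identities
      N_y    = sum over z adjacent to y of
               p(y,z) * product of q(y,w) over the w <> z adjacent to y,
      p(x,y) = the same expression with x left out of both the sum and the
               products
    ([mult_side_sum], [pnear_side_sum]), and hence
      N_y = q(y,x) p(x,y) + Q({x,y},y) p(y,x)     ([mult_edge]).

    Combining the last identity at both ends of an edge, det < 0 and p(x,y) > 0
    for x < y give q(x,y) N_y < Q({x,y},y) N_x ([mult_up]). As N is nowhere
    negative, all neighbours above a dicritical vertex w are arrows, and w lies
    above each neighbour y with N_y > 0. The arrows decorated by (1) at w have
    decoration 1 near w because of the dead end there, so p(y,w) = d_w A with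
    A = Q({y,w},w); then N_w = 0 gives p(w,y) = - q(w,y) d_w. Both are multiples
    of d_w, so a dicritical vertex behaves like a neighbour in the subtree
    N > 0 whose characteristic number is d_w.

    The theorem follows by induction on oriented edges, going away from x
    ([multiples_charnum]). For e = {x,y} let g = a_y c(x,e), the gcd that
    precedes the division by a_y. By induction, or by the case of dicritical
    vertices, g divides all p(y,z), p(z,y) with z <> x not the end of a dead
    end. It divides N_y, which is d(y) or, when y is a node, a combination of
    the two numbers of an edge to a dicritical vertex. So g divides p(x,y), which is a combination of the p(y,z). For
    p(y,x), reading p(z,y) and N_y at y shows that g divides
    a_y R p(y,x), where R is the product of q(y,w) over all w <> x that are not
    the end of a dead end, possibly with one factor left out. The q(y,w) are
    pairwise coprime, so these R generate the unit ideal and g divides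
    a_y p(y,x) ([multiples_step]). *)

(** * Multiples of a rational number *)

Section Multiples.

Variable c : rat.
Implicit Types (x y : rat) (m n : int).

Lemma in_multiples0 : in_multiples c 0.
Proof. by exists 0; rewrite mulr0. Qed.

Lemma in_multiplesD x y :
  in_multiples c x -> in_multiples c y -> in_multiples c (x + y).
Proof. by move=> [k ->] [l ->]; exists (k + l); rewrite rmorphD mulrDr. Qed.

Lemma in_multiplesMz m x : in_multiples c x -> in_multiples c (m%:~R * x).
Proof. by move=> [k ->]; exists (m * k); rewrite rmorphM mulrCA. Qed.

Lemma in_multiplesB x y :
  in_multiples c x -> in_multiples c y -> in_multiples c (x - y).
Proof.
move=> cx /(in_multiplesMz (-1)); rewrite rmorphN1 mulN1r.
exact: in_multiplesD.
Qed.

Lemma in_multiples_sum (I : finType) (P : pred I) (F : I -> int) :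
  (forall i, P i -> in_multiples c (F i)%:~R) ->
  in_multiples c (\sum_(i | P i) F i)%:~R.
Proof.
move=> cF; rewrite rmorph_sum; apply: (big_ind (in_multiples c)) => //.
- exact: in_multiples0.
- exact: in_multiplesD.
Qed.

Lemma in_multiples_trans d x :
  in_multiples c d -> in_multiples d x -> in_multiples c x.
Proof. by move=> cd [k ->]; rewrite mulrC; apply: in_multiplesMz. Qed.

Lemma in_multiples_div (a : int) x :
  a != 0 -> in_multiples c (a%:~R * x) -> in_multiples (c / a%:~R) x.
Proof.
move=> a0 [k ck]; exists k; have a0' : a%:~R != 0 :> rat by rewrite intr_eq0.
by apply: (mulfI a0'); rewrite ck [c / _]mulrC -mulrA mulVKf.
Qed.

(** Bezout turns pairwise coprimality into cancellation: the products of the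
    [f z] with one factor left out generate the unit ideal of the integers. The
    full product is required as well so that the empty set is covered. *)
Lemma in_multiples_coprime (I : finType) (C : {set I}) (f : I -> int) x :
  (forall z1 z2, z1 \in C -> z2 \in C -> z1 != z2 -> coprimez (f z1) (f z2)) ->
  in_multiples c ((\prod_(z in C) f z)%:~R * x) ->
  (forall z, z \in C -> in_multiples c ((\prod_(w in C :\ z) f w)%:~R * x)) ->
  in_multiples c x.
Proof.
have [n] := ubnP #|C|; elim: n => // n IHn in C x *; rewrite ltnS => leCn.
move=> cop cC cCz.
have [C0 | [z zC]] := set_0Vmem C; first by move: cC; rewrite C0 big_set0 mul1r.
have cf w : w \in C -> in_multiples c ((f w)%:~R * x).
  move=> wC; apply: (IHn (C :\ w)).
  - by move: leCn; rewrite (cardsD1 w) wC.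
  - by move=> z1 z2 /setD1P[_ z1C] /setD1P[_ z2C]; apply: cop.
  - by rewrite mulrA -rmorphM [_ * f w]mulrC -(big_setD1 w wC).
  - move=> z1 /setD1P[nz1 z1C]; rewrite mulrA -rmorphM.
    have := cCz z1 z1C; rewrite (big_setD1 w) /=; last by rewrite !inE eq_sym nz1.
    suff -> : C :\ w :\ z1 = C :\ z1 :\ w by rewrite [_ * f w]mulrC.
    by rewrite !setDDl setUC.
have [Cz0 | [w /setD1P[nwz wC]]] := set_0Vmem (C :\ z).
  by have := cCz z zC; rewrite Cz0 big_set0 mul1r.
have /coprimezP[[k l] /= kl] := cop w z wC zC nwz.
have := in_multiplesD (in_multiplesMz k (cf w wC)) (in_multiplesMz l (cf z zC)).
by rewrite !mulrA -!rmorphM -mulrDl -rmorphD kl mul1r.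
Qed.

End Multiples.

Lemma in_multiples_int (m n : int) : (m %| n)%Z -> in_multiples m%:~R n%:~R.
Proof. by case/dvdzP=> k ->; exists k; rewrite rmorphM mulrC. Qed.

Lemma in_multiples_rat_gcd (s : seq rat) x :
  x \in s -> in_multiples (rat_gcd s) x.
Proof.
elim: s => //= y s IHs; rewrite inE => /orP[/eqP<-|/IHs[k xE]].
  by apply/rat_gcd2_span; exists 1, 0; rewrite mulr1 mulr0 addr0.
by apply/rat_gcd2_span; exists 0, k; rewrite mulr0 add0r.
Qed.

(** * Paths and branches in a tree *)

Section Tree.

Variable T : decorated_tree.
Implicit Types (x y z u v w a : T) (e : {set T}) (p : seq T).

Lemma gamma_tailP x y : simple_path (edges T) x y (gamma_tail x y).
Proof. exact: xchooseP (simple_path_ex x y). Qed.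

Lemma gamma_tail_unique x y p :
  simple_path (edges T) x y p -> gamma_tail x y = p.
Proof.
have [p' [_ uniqp]] := tree_path x y => sp.
by rewrite -(uniqp _ sp) (uniqp _ (gamma_tailP x y)).
Qed.

Lemma gamma_uniq x y : uniq (gamma x y).
Proof. by case/and3P: (gamma_tailP x y). Qed.

Lemma gamma_notin x y : x \notin gamma_tail x y.
Proof. by have /andP[] := gamma_uniq x y. Qed.

Lemma gamma_tail_adj x y : adj x y -> gamma_tail x y = [:: y].
Proof.
move=> xy; apply: gamma_tail_unique.
by rewrite /simple_path /= -/(adj x y) xy !inE eqxx (adj_neq xy).
Qed.

(** A path leaving the cell at the far end of an edge either avoids the near
    end, and then extends to it, or passes through it at once, since the edge is
    the only path between its ends. *)
Lemma gamma_tail_step x y a : adj x y ->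
  gamma_tail x a = y :: gamma_tail y a \/ gamma_tail y a = x :: gamma_tail x a.
Proof.
move=> xy; have [|nx] := boolP (x \in gamma y a); last first.
  left; apply: gamma_tail_unique; have /and3P[pth uq lst] := gamma_tailP y a.
  apply/and3P; split; [exact/andP | | exact: lst].
  by rewrite cons_uniq uq andbT.
rewrite inE (negPf (adj_neq xy)) /= => xg; right.
move: (gamma_tailP y a); case/path.splitP: xg => p1 p2 /and3P[].
rewrite cat_path -cat_cons cat_uniq last_cat last_rcons.
move=> /andP[pth1 pth2] /and3P[uq1 dis uq2] lst.
have sp1 : simple_path (edges T) y x (rcons p1 x).
  by rewrite /simple_path pth1 uq1 last_rcons eqxx.
have := gamma_tail_unique sp1; rewrite gamma_tail_adj 1?adj_sym // => p1E.
rewrite -p1E; congr (_ :: _); apply/esym/gamma_tail_unique.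
rewrite /simple_path pth2 lst andbT /= uq2 andbT.
by apply: contra dis => xp2; apply/hasP; exists x; rewrite // -p1E !inE eqxx orbT.
Qed.

Lemma gamma_tail_refl x : gamma_tail x x = [::].
Proof. by apply: gamma_tail_unique; rewrite /simple_path /= eqxx. Qed.

(** The first cell after [x] on the way to [a]: it names the branch at [x] that
    contains [a], and turns membership of an edge in a path into an equation. *)
Definition step x a : T := head x (gamma_tail x a).

Lemma step_refl a : step a a = a.
Proof. by rewrite /step gamma_tail_refl. Qed.

Lemma gamma_tail_cons x a : x != a ->
  adj x (step x a) /\ gamma_tail x a = step x a :: gamma_tail (step x a) a.
Proof.
move=> nxa; have /and3P[] := gamma_tailP x a; have := gamma_notin x a.
rewrite /step; case E: (gamma_tail x a) => [|y p] /=; first by rewrite (negPf nxa).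
move=> _ /andP[xy _] _ _; split=> //; case: (gamma_tail_step a xy).
  by rewrite E.
by move=> yE; have := gamma_notin y a; rewrite yE E !inE eqxx orbT.
Qed.

Lemma step_adj x a : x != a -> adj x (step x a).
Proof. by case/gamma_tail_cons. Qed.

Lemma gamma_cons x a : x != a -> gamma x a = x :: gamma (step x a) a.
Proof. by move=> nxa; rewrite /gamma; have [_ {1}->] := gamma_tail_cons nxa. Qed.

Lemma gamma_edges_cons x a : x != a ->
  gamma_edges x a = [set x; step x a] :: gamma_edges (step x a) a.
Proof.
by move=> nxa; rewrite /gamma_edges; have [_ {1}->] := gamma_tail_cons nxa.
Qed.

Lemma notin_gamma_step x a : x != a -> x \notin gamma (step x a) a.
Proof.
by move=> nxa; have := gamma_notin x a; have [_ {1}->] := gamma_tail_cons nxa.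
Qed.

Lemma step_in_gamma x y a : adj x y -> y \in gamma x a -> step x a = y.
Proof.
move=> xy; rewrite inE eq_sym (negPf (adj_neq xy)) /= => yx.
case: (gamma_tail_step a xy) => [|yE]; first by rewrite /step => ->.
by have := gamma_notin y a; rewrite yE inE yx orbT.
Qed.

(** Removing an edge of a tree leaves two components; this decides which one
    contains [a]. *)
Lemma step_eqC x y a : adj x y -> (step x a == y) = (step y a != x).
Proof.
move=> xy; have nxy := adj_neq xy.
have [yE|nyE] := eqVneq (step y a) x; last first.
  case: (gamma_tail_step a xy); first by rewrite /step => ->; rewrite eqxx.
  by move=> yE; rewrite /step yE eqxx in nyE.
have nya : y != a.
  by apply: contra nxy => /eqP ya; move: yE; rewrite -ya step_refl => ->.
apply: contraNF (notin_gamma_step nya) => /eqP xE; rewrite yE.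
have [xa|nxa] := eqVneq x a.
  by move: xE; rewrite -xa step_refl => xy'; rewrite xy' eqxx in nxy.
by rewrite (gamma_cons nxa) inE xE inE eqxx orbT.
Qed.

Lemma edge_pair x y e : e \in edges T -> x \in e -> y \in e -> x != y ->
  e = [set x; y].
Proof.
move=> eE xe ye nxy; apply/esym/eqP; rewrite eqEcard cards2 nxy edge_card //.
by rewrite andbT; apply/subsetP => z; rewrite in_set2 => /orP[]/eqP->.
Qed.

Lemma gamma_edges_sub x a e u : e \in gamma_edges x a -> u \in e ->
  u \in gamma x a.
Proof.
rewrite /gamma_edges /gamma; move: (gamma_tail x a) => p; elim: p x => //= y p IHp x.
rewrite inE => /predU1P[->|/IHp up ue]; last by rewrite inE up ?orbT.
by rewrite !inE => /orP[]/eqP->; rewrite eqxx ?orbT.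
Qed.

Lemma pair_setI x y z : x != y -> [set x; y] = [set x; z] -> y = z.
Proof.
move=> nxy /setP/(_ y); rewrite !inE eqxx orbT eq_sym (negPf nxy) /=.
by move/esym/eqP.
Qed.

Lemma mem_gamma_edges x y a : adj x y ->
  ([set x; y] \in gamma_edges x a) = (step x a == y).
Proof.
move=> xy; have nxy := adj_neq xy; have [<-|nxa] := eqVneq x a.
  by rewrite step_refl /gamma_edges gamma_tail_refl (negPf nxy).
rewrite gamma_edges_cons // inE; apply/orP/eqP => [[/eqP/(pair_setI nxy) //|]|->].
  move/gamma_edges_sub => /(_ x (set21 _ _)).
  by rewrite (negPf (notin_gamma_step nxa)).
by left.
Qed.

Lemma gamma_rev x y : gamma y x = rev (gamma x y).
Proof.
have /and3P[pth uq /eqP lst] := gamma_tailP x y.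
have revE : rev (gamma x y) = y :: rev (belast x (gamma_tail x y)).
  by rewrite /gamma lastI lst rev_rcons.
rewrite revE /gamma; congr (_ :: _); apply: gamma_tail_unique.
rewrite /simple_path -revE rev_uniq uq -[X in path _ X _]lst rev_path.
rewrite (eq_path (e' := fun a b => [set a; b] \in edges T)) => [|a b]; last first.
  by rewrite setUC.
rewrite pth /=; case: (gamma_tail x y) lst => [|z p] /= lst; first by rewrite lst.
by rewrite rev_cons last_rcons.
Qed.

Lemma gamma_cat a b y : y \in gamma a b ->
  gamma a b = gamma a y ++ gamma_tail y b.
Proof.
rewrite inE => /predU1P[->|yab]; first by rewrite /gamma gamma_tail_refl.
move: (gamma_tailP a b); rewrite /gamma; case/path.splitP: yab => p1 p2 /and3P[].
rewrite cat_path -cat_cons cat_uniq last_cat last_rcons.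
move=> /andP[pth1 pth2] /and3P[uq1 dis uq2] lst.
congr (_ ++ _).
  by rewrite (@gamma_tail_unique a y (rcons p1 y)) // /simple_path pth1 uq1 last_rcons /=.
apply/esym/gamma_tail_unique; rewrite /simple_path pth2 lst andbT /= uq2 andbT.
apply: contra dis => yp2; apply/hasP; exists y => //.
by rewrite !inE mem_rcons inE eqxx orbT.
Qed.

(** A cell between [a] and [b] sees them in different branches, for otherwise the
    path would use the first cell of that branch twice. *)
Lemma step_opposite a b y : y \in gamma a b -> y != a -> y != b ->
  step y a != step y b.
Proof.
move=> yab nya nyb; apply/eqP => ab; have := gamma_uniq a b.
rewrite (gamma_cat yab) cat_uniq => /and3P[_ /hasPn/(_ (step y b)) dis _].
have [_ bE] := gamma_tail_cons nyb.
have: step y b \notin gamma a y by apply: dis; rewrite bE inE eqxx.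
by rewrite -ab gamma_rev mem_rev gamma_cons // !inE eqxx orbT.
Qed.

(** On an edge the order is decided by the branch containing the root, which
    makes it accessible to [step_eqC]. *)
Lemma tree_lt_adj x y : adj x y -> tree_lt x y = (step y (Defs.root T) == x).
Proof.
move=> xy; have nxy := adj_neq xy.
rewrite /tree_lt nxy gamma_rev mem_rev; apply/idP/eqP => [|yx].
  by apply: step_in_gamma; rewrite adj_sym.
have nyr : y != Defs.root T.
  by apply: contra nxy => /eqP yr; rewrite -yx yr step_refl.
by rewrite gamma_cons // yx !inE eqxx orbT.
Qed.

Lemma tree_lt_total x y : adj x y -> tree_lt x y || tree_lt y x.
Proof.
move=> xy; have yx : adj y x by rewrite adj_sym.
rewrite (tree_lt_adj xy) (tree_lt_adj yx) (step_eqC _ yx).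
exact: orNb.
Qed.

Lemma tree_lt_away x y z : adj x y -> adj y z -> tree_lt x y -> z != x ->
  tree_lt y z.
Proof.
move=> xy yz; rewrite !tree_lt_adj // => /eqP yx nzx.
by rewrite step_eqC 1?adj_sym // yx eq_sym.
Qed.

(** Induction going away from [x] along the edges. It is well founded because the
    set of cells beyond the edge, measured by [step], strictly decreases. *)
Lemma edge_ind (P : T -> T -> Prop) :
  (forall x y, adj x y -> (forall z, adj y z -> z != x -> P y z) -> P x y) ->
  forall x y, adj x y -> P x y.
Proof.
move=> IP x y; have [n] := ubnP #|[set a | step x a == y]|.
elim: n => // n IHn in x y *; rewrite ltnS => len xy.
apply: (IP _ _ xy) => z yz nzx; apply: (IHn _ _ _ yz).
apply: leq_trans len; apply/proper_card/properP; split.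
  by apply/subsetP => a; rewrite !inE (step_eqC _ xy) => /eqP->.
exists y; rewrite !inE; first by rewrite step_eqC // step_refl eq_sym adj_neq.
by rewrite step_refl adj_neq.
Qed.

(** * Local identities for the numbers p and N *)

Definition nbrs x : {set T} := [set y | adj x y].
Definition qnear x y : int := q [set x; y] x.

Lemma prod_inc_edges (P : pred {set T}) x :
  \prod_(e in inc_edges x | P e) q e x =
  \prod_(y in nbrs x | P [set x; y]) qnear x y.
Proof.
have -> : inc_edges x = [set [set x; y] | y in nbrs x].
  apply/setP => e; apply/idP/imsetP; last first.
    by case=> y; rewrite !inE => xy ->; rewrite set21 andbT.
  rewrite inE => /andP[eE xe]; have /eqP/cards2P[y [z [nyz eyz]]] := edge_card eE.
  have [w nxw ew] : exists2 w, x != w & e = [set x; w].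
    move: xe; rewrite eyz in_set2 => /orP[]/eqP->; first by exists z.
    by exists y; rewrite 1?eq_sym // setUC.
  by exists w => //; rewrite inE /adj -ew.
rewrite big_imset_cond // => y z; rewrite !inE => xy _.
exact/pair_setI/adj_neq.
Qed.

Lemma prod_inc_edge1 x y : adj x y ->
  \prod_(e in inc_edges x | e != [set x; y]) q e x =
  \prod_(w in nbrs x :\ y) qnear x w.
Proof.
move=> xy; rewrite prod_inc_edges; apply: eq_bigl => w; rewrite !inE andbC.
by congr (_ && _); congr (~~ _); apply/eqP/eqP => [/esym/(pair_setI (adj_neq xy))|->].
Qed.

(** The first cell of the path contributes nothing, all of its edges containing
    it. As trees have no chords, the remaining cells lose only the edge by which
    the path leaves its first cell. *)
Lemma xhat_tail v a : v != a ->
  xhat v a = \prod_(u <- gamma (step v a) a)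
               \prod_(e in inc_edges u | e \notin gamma_edges v a) q e u.
Proof.
move=> nva; rewrite /xhat gamma_cons // big_cons big1 ?mul1r; last first.
  by move=> e; rewrite inE => /andP[/andP[_ ->] /andP[_]].
apply: eq_big_seq => u uy; apply: eq_bigl => e.
case: (boolP (e \in inc_edges u)) => //=; rewrite inE => /andP[eE ue].
apply: andb_idr; apply: contra => ve.
have nvu : v != u by apply: contra (notin_gamma_step nva) => /eqP{1}->.
have euv := edge_pair eE ve ue nvu.
have vu : adj v u by rewrite /adj -euv.
rewrite euv mem_gamma_edges //; apply/eqP/step_in_gamma => //.
by rewrite gamma_cons // inE uy orbT.
Qed.

Lemma xnumE x a : x != a ->
  xnum x a = (\prod_(w in nbrs x :\ step x a) qnear x w) * xhat x a.
Proof.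
move=> nxa; rewrite /xnum gamma_cons // big_cons -xhat_tail //; congr (_ * _).
rewrite -prod_inc_edge1 ?step_adj //; apply: eq_bigl => e.
case: (boolP (e \in inc_edges x)) => //=; rewrite inE => /andP[eE xe].
rewrite gamma_edges_cons // inE negb_or; apply: andb_idr => _.
by apply: contra (notin_gamma_step nxa) => eg; apply: gamma_edges_sub eg xe.
Qed.

Lemma xhatE x y a : adj x y -> step x a = y -> y != a ->
  xhat x a = (\prod_(w in nbrs y :\ x :\ step y a) qnear y w) * xhat y a.
Proof.
move=> xy xa nya.
have nxa : x != a.
  by apply: contra (adj_neq xy) => /eqP xa'; rewrite -xa -xa' step_refl.
have nx := notin_gamma_step nxa; rewrite xa in nx.
rewrite !xhat_tail // (gamma_edges_cons nxa) xa gamma_cons // big_cons.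
congr (_ * _).
  rewrite prod_inc_edges; apply: eq_bigl => w; rewrite !inE negb_or.
  case: (boolP (adj y w)) => yw; rewrite ?andbF // !andbT mem_gamma_edges //.
  rewrite [_ == w]eq_sym /= andbC [[set x; y]]setUC; congr (_ && _); congr (~~ _).
  by apply/eqP/eqP => [/esym/pair_setI->|->]; rewrite // eq_sym adj_neq.
apply: eq_big_seq => u uy; apply: eq_bigl => e.
case: (boolP (e \in inc_edges u)) => //=; rewrite inE => /andP[eE ue].
rewrite inE negb_or; apply: andb_idl => _.
apply: contraTN ue => /eqP->; rewrite in_set2 negb_or.
apply/andP; split; apply: contraTN uy => /eqP->; last exact: notin_gamma_step.
by apply: contra nx => xz; rewrite gamma_cons // inE xz orbT.
Qed.

Lemma arrow_nbr x y a : a \in arrows T -> adj a x -> adj a y -> x = y.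
Proof.
rewrite 3!inE => /andP[_ /eqP/eqP/cards1P[e ae]] ax ay.
have := set11 e; have: [set a; x] \in inc_edges a by rewrite inE -/(adj a x) ax set21.
have: [set a; y] \in inc_edges a by rewrite inE -/(adj a y) ay set21.
rewrite ae !inE => /eqP<- /eqP/pair_setI -> //; exact: adj_neq.
Qed.

Lemma xhat_arrow x a : a \in arrows T -> adj x a -> xhat x a = 1.
Proof.
move=> aA xa; have nxa := adj_neq xa.
have sxa : step x a = a.
  by apply: step_in_gamma; rewrite // /gamma gamma_tail_adj // !inE eqxx orbT.
rewrite xhat_tail // sxa /gamma gamma_tail_refl big_seq1 prod_inc_edges big1 // => w.
rewrite inE => /andP[aw].
have -> : w = x by apply: arrow_nbr aA aw _; rewrite adj_sym.
rewrite setUC.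
by rewrite mem_gamma_edges // sxa eqxx.
Qed.

Definition pnear x y : int := pnum x [set x; y].

(** The numerator of the sum of [pnear y z / qnear y z] over [B] when the product
    of the [qnear y z] is taken as common denominator. Written without division,
    as decorations may vanish. *)
Definition side_sum y (B : {set T}) : int :=
  \sum_(z in B) (\prod_(w in B :\ z) qnear y w) * pnear y z.

Lemma pnearE x y : adj x y ->
  pnear x y = \sum_(a in arrows1 T | step x a == y) xhat x a.
Proof.
move=> xy; apply: eq_bigl => a.
by rewrite [LHS]inE mem_gamma_edges.
Qed.

Lemma pnum'_pnear x y : adj x y -> pnum' x [set x; y] = pnear y x.
Proof.
move=> xy; rewrite /pnum' other_endE ?adj_neq // pnearE 1?adj_sym //.
apply: eq_bigl => a; rewrite in_setD [a \in arrowsA _ _]inE mem_gamma_edges //.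
by rewrite step_eqC // negb_and negbK; case: (a \in _); rewrite ?andbT ?andbF.
Qed.

Lemma arrows1_arrow a : a \in arrows1 T -> a \in arrows T.
Proof. by case/setDP. Qed.

Lemma vertex_arrow1 y a : y \in vertices T -> a \in arrows1 T -> y != a.
Proof.
by move=> yV /arrows1_arrow aA; apply: contraTneq yV => ->; rewrite inE aA.
Qed.

(** Each arrow is counted at the neighbour through which the path from [y] to it
    leaves [y]; [pnear_side_sum] uses the same partition. *)
Lemma mult_side_sum y : y \in vertices T -> mult y = side_sum y (nbrs y).
Proof.
move=> yV; rewrite /mult (partition_big (step y) (mem (nbrs y))) /=; last first.
  by move=> a aA; rewrite inE step_adj // vertex_arrow1.
apply: eq_bigr => z; rewrite inE => yz; rewrite pnearE // big_distrr.
by apply: eq_bigr => a /andP[aA /eqP<-]; rewrite xnumE // vertex_arrow1.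
Qed.

Lemma pnear_side_sum x y : adj x y -> y \in vertices T ->
  pnear x y = side_sum y (nbrs y :\ x).
Proof.
move=> xy yV; rewrite pnearE //.
rewrite (partition_big (step y) (mem (nbrs y :\ x))) /=; last first.
  move=> a /andP[aA]; rewrite step_eqC // => nya.
  by rewrite !inE nya step_adj // vertex_arrow1.
apply: eq_bigr => z; rewrite !inE => /andP[nzx yz]; rewrite pnearE // big_distrr.
apply: eq_big => [a|a /andP[/andP[aA /eqP xa] /eqP<-]]; last first.
  by rewrite (xhatE xy) // vertex_arrow1.
by rewrite -andbA step_eqC //; case: (eqVneq (step y a) z) => [->|]; rewrite ?nzx ?andbF.
Qed.

Lemma side_sum_rem y z (B : {set T}) : z \in B ->
  side_sum y B = qnear y z * side_sum y (B :\ z)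
                 + (\prod_(w in B :\ z) qnear y w) * pnear y z.
Proof.
move=> zB; rewrite /side_sum (big_setD1 z zB) /= addrC [qnear y z * _]mulr_sumr.
congr (_ + _); apply: eq_bigr => w /setD1P[nwz wB].
rewrite mulrA (big_setD1 z) /=; last by rewrite !inE eq_sym nwz.
by rewrite !setDDl setUC.
Qed.

Lemma pnear_arrow0 x a : a \in arrows0 T -> adj x a -> pnear x a = 0.
Proof.
move=> a0 xa; have nxa := adj_neq xa; rewrite pnearE // big1 // => b.
move=> /andP[b1]; rewrite step_eqC // => nab.
case/setDP: b1 => bA nb0.
have nba : a != b by apply: contraNneq nb0 => <-.
have aA : a \in arrows T by move: a0; rewrite inE => /andP[].
case/eqP: nab; apply: arrow_nbr aA _ _; first exact: step_adj.
by rewrite adj_sym.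
Qed.

Lemma pnear_arrow1 x a : a \in arrows1 T -> adj x a -> pnear x a = 1.
Proof.
move=> a1 xa; have nxa := adj_neq xa; rewrite pnearE //.
have aA := arrows1_arrow a1.
rewrite (bigD1 a) /=; last by rewrite a1 step_eqC // step_refl eq_sym.
rewrite xhat_arrow // big1 ?addr0 // => b /andP[/andP[b1]].
rewrite step_eqC // => nab; rewrite eq_sym => nba.
by case/eqP: nab; apply: arrow_nbr aA _ _; [exact: step_adj | rewrite adj_sym].
Qed.

Lemma bigQE x y : adj x y ->
  bigQ [set x; y] x = \prod_(w in nbrs x :\ y) qnear x w.
Proof. exact: prod_inc_edge1. Qed.

Lemma arrow_cases a : a \in arrows T -> (a \in arrows0 T) || (a \in arrows1 T).
Proof. by move=> aA; rewrite in_setD aA andbT orbN. Qed.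

Lemma mult_edge x y : x \in vertices T -> y \in vertices T -> adj x y ->
  mult x = qnear x y * pnear y x + bigQ [set x; y] x * pnear x y.
Proof.
move=> xV yV xy; rewrite mult_side_sum // (@side_sum_rem _ y) ?inE //.
by rewrite -pnear_side_sum 1?adj_sym // bigQE.
Qed.

End Tree.

(** * Positivity and dead ends in Newton trees *)

Section NewtonTree.

Variable T : decorated_tree.
Hypothesis hT : newton_tree T.
Implicit Types (x y z u v w a : T) (e : {set T}).

Lemma up_edge_pair v z : adj v z -> tree_lt v z -> [set v; z] \in up_edges v.
Proof.
move=> vz lt_vz; rewrite inE -/(adj v z) vz; apply/existsP.
by exists z; rewrite eqxx.
Qed.

Lemma qnear_ge1 v z : v \in vertices T -> adj v z -> tree_lt v z ->
  1 <= qnear v z.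
Proof. by move=> vV vz lt_vz; apply/(newton_up_ge1 hT vV)/up_edge_pair. Qed.

(** Above [y] all decorations are positive, so in the local identity every term is
    nonnegative. Positivity at a vertex comes from the branch of an arrow
    decorated by (1): that branch cannot consist of a dead end. *)
Lemma pnear_up x y : adj x y -> tree_lt x y ->
  0 <= pnear x y /\ (y \in vertices T -> 0 < pnear x y).
Proof.
move: x y; apply: edge_ind => x y xy IHz lt_xy.
have lt_y z : z \in nbrs y :\ x -> adj y z /\ tree_lt y z.
  rewrite !inE => /andP[nzx yz]; split=> //; exact: tree_lt_away lt_xy nzx.
have [yV|] := boolP (y \in vertices T); last first.
  rewrite inE negbK => /arrow_cases/orP[y0|y1]; split=> //.
    by rewrite pnear_arrow0.
  by rewrite pnear_arrow1.
suff pos : 0 < pnear x y by split=> //; apply: ltW.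
rewrite pnear_side_sum //.
have pos_prod (B : {set T}) : B \subset nbrs y :\ x -> 0 < \prod_(w in B) qnear y w.
  move=> /subsetP sB; apply: prodr_gt0 => w /sB/lt_y[yw ltyw].
  exact: lt_le_trans (qnear_ge1 yV yw ltyw).
have [a a1 lt_ya] := newton_arrow hT yV.
set z := step y a; have nya := vertex_arrow1 yV a1.
have yz : adj y z := step_adj nya.
have yr : step y (Defs.root T) = x by apply/eqP; rewrite -tree_lt_adj.
have nzx : z != x.
  rewrite -yr eq_sym; apply: step_opposite => //; first by case/andP: lt_ya.
  by apply: contraTneq (adj_neq xy) => y_r; rewrite -yr -y_r step_refl eqxx.
have zB : z \in nbrs y :\ x by rewrite !inE nzx.
have [_ lt_yz] := lt_y z zB.
rewrite /side_sum (big_setD1 z) //=; apply: ltr_pwDl.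
  apply: mulr_gt0; first exact/pos_prod/subD1set.
  have [zV|] := boolP (z \in vertices T); first by case: (IHz z yz nzx lt_yz) => _; apply.
  rewrite inE negbK => zA; have /orP[z0|z1] := arrow_cases zA; last first.
    by rewrite pnear_arrow1.
  have nza : z != a by apply: contraTneq z0 => ->; case/setDP: a1.
  have: step z a != y by rewrite -step_eqC // eqxx.
  by case/eqP; apply: arrow_nbr zA _ _; rewrite ?step_adj // adj_sym.
apply: sumr_ge0 => w /setD1P[_ wB]; have [yw lt_yw] := lt_y w wB.
apply: mulr_ge0; first exact/ltW/pos_prod/subD1set.
by case: (IHz w yw _ lt_yw) => //; case/setD1P: wB.
Qed.

(** Eliminating [pnear y x] from the two local identities of the edge leaves its
    determinant times the positive number [pnear x y]. *)
Lemma mult_up x y : x \in vertices T -> y \in vertices T -> adj x y ->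
  tree_lt x y -> qnear x y * mult y < bigQ [set y; x] y * mult x.
Proof.
move=> xV yV xy lt_xy; have yx : adj y x by rewrite adj_sym.
rewrite (mult_edge xV yV xy) (mult_edge yV xV yx).
have [_ /(_ yV) p_gt0] := pnear_up xy lt_xy.
rewrite -subr_lt0.
suff -> : forall m n : int,
    qnear x y * (qnear y x * pnear x y + bigQ [set y; x] y * m)
      - bigQ [set y; x] y * (qnear x y * m + n * pnear x y)
    = (qnear x y * qnear y x - n * bigQ [set y; x] y) * pnear x y.
  by rewrite pmulr_llt0 // /qnear [[set y; x]]setUC; apply: (newton_det hT).
by move=> m n; ring.
Qed.

(** At most one edge going up from [w] has a decoration larger than 1, and the
    dead end is such an edge as soon as there is one. *)
Lemma qnear_arrow1 w a e : w \in vertices T -> e \in dead_ends_at w ->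
  e \in up_edges w -> a \in arrows1 T -> adj w a -> tree_lt w a ->
  qnear w a = 1.
Proof.
move=> wV ew e_up a1 wa lt_wa; have a_up := up_edge_pair wa lt_wa.
apply/eqP; rewrite eq_le qnear_ge1 // andbT leNgt; apply/negP => gt1.
have [_ /(_ _ a_up) le_e] := newton_dead_end_max hT wV ew.
have /card_le1_eqP eq1 := newton_up_gt1 hT wV.
have e_eq : e = [set w; a].
  by apply: eq1; rewrite inE ?e_up ?a_up //= (lt_le_trans gt1).
move: ew; rewrite !inE e_eq => /andP[/andP[_ /existsP[z /andP[z0 ze]]] _].
move: ze; rewrite in_set2 => /orP[]/eqP zE; rewrite zE in z0.
  by move: wV; rewrite inE; case/setIdP: z0 => ->.
by case/setDP: a1; rewrite z0.
Qed.

Lemma dead_end_pair w e : w \in vertices T -> e \in dead_ends_at w ->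
  exists2 z, z \in nbrs w :&: arrows0 T & e = [set w; z].
Proof.
move=> wV; rewrite !inE => /andP[/andP[eE /existsP[z /andP[z0 ze]]] we].
have nwz : w != z.
  by apply: contraTneq wV => ->; rewrite inE negbK; case/setIdP: z0.
have ewz := edge_pair eE we ze nwz; exists z => //.
by rewrite inE z0 andbT inE /adj -ewz.
Qed.

Lemma mem_dead_ends w z : z \in nbrs w :&: arrows0 T ->
  [set w; z] \in dead_ends_at w.
Proof.
case/setIP; rewrite inE => wz z0; rewrite 2!inE set21 andbT -/(adj w z) wz /=.
by apply/existsP; exists z; rewrite z0 set22.
Qed.

Lemma dead_dec_prod v : v \in vertices T ->
  dead_dec v = \prod_(z in nbrs v :&: arrows0 T) qnear v z.
Proof.
move=> vV; rewrite /dead_dec; case: pickP => [e ev|no_e]; last first.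
  by rewrite big1 // => z /mem_dead_ends; rewrite no_e.
have [z zB ->] := dead_end_pair vV ev.
have /card_le1_eqP eq1 := newton_dead_end hT vV.
suff -> : nbrs v :&: arrows0 T = [set z] by rewrite big_set1.
apply/setP => w; rewrite in_set1; apply/idP/eqP => [wB|->//].
apply/esym; apply: (@pair_setI _ v).
  by apply: adj_neq; case/setIP: zB; rewrite inE.
by apply: eq1; apply: mem_dead_ends.
Qed.

Lemma dead_dec_neq0 v : v \in vertices T -> dead_dec v != 0.
Proof.
move=> vV; rewrite /dead_dec; case: pickP => // e ev.
have [[e' e'_up ->] _] := newton_dead_end_max hT vV ev.
by rewrite gt_eqF // (lt_le_trans _ (newton_up_ge1 hT vV e'_up)).
Qed.

(** * Dicritical vertices *)

Section MinimallyComplete.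

Hypothesis hmin : minimally_complete T.

Lemma dicriticalP w :
  reflect (w \in vertices T /\ mult w = 0) (w \in dicriticals T).
Proof. by apply: (iffP setIdP) => -[wV /eqP]. Qed.

Lemma subN_vertex y : y \in subN T -> y \in vertices T.
Proof. by case/setIdP. Qed.

(** Multiplicities would become negative above a dicritical vertex. *)
Lemma dicritical_up w z : w \in dicriticals T -> adj w z -> tree_lt w z ->
  z \notin vertices T.
Proof.
case/dicriticalP=> wV w0 wz lt_wz; apply/negP => zV.
have := mult_up wV zV wz lt_wz; rewrite w0 mulr0 ltNge => /negP[].
apply: mulr_ge0; last exact: mc_mult_ge0.
exact: le_trans (qnear_ge1 wV wz lt_wz).
Qed.

Section Dicritical.

Variables (y w : T).
Hypotheses (yN : y \in subN T) (wD : w \in dicriticals T) (yw : adj y w).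

Let wV : w \in vertices T. Proof. by case/dicriticalP: wD. Qed.
Let wy : adj w y. Proof. by rewrite adj_sym. Qed.

Lemma dicritical_lt : tree_lt y w.
Proof.
have /orP[//|lt_wy] := tree_lt_total yw.
by have := dicritical_up wD wy lt_wy; rewrite subN_vertex.
Qed.

Lemma dicritical_nbr z : z \in nbrs w :\ y ->
  [/\ adj w z, tree_lt w z & z \in arrows T].
Proof.
rewrite in_setD1 => /andP[nzy]; rewrite inE => wz.
have lt_wz := tree_lt_away yw wz dicritical_lt nzy.
by split=> //; have := dicritical_up wD wz lt_wz; rewrite inE negbK.
Qed.

Lemma dicritical_arrow1 a : a \in arrows1 T -> adj w a ->
  a \in nbrs w :\ y /\ qnear w a = 1.
Proof.
move=> a1 wa; have aB : a \in nbrs w :\ y.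
  by rewrite !inE wa andbT eq_sym vertex_arrow1 // subN_vertex.
split=> //; have [_ lt_wa _] := dicritical_nbr aB.
have [e ew] := mc_dicritical hmin wD.
apply: (qnear_arrow1 wV ew) => //; have [z /setIP[]] := dead_end_pair wV ew.
rewrite inE => wz z0 ->; apply: up_edge_pair => //.
apply: (tree_lt_away yw wz dicritical_lt).
apply: contraTneq (subN_vertex yN) => <-; rewrite inE negbK.
by case/setIdP: z0.
Qed.

(** The decorations at [w] of its arrows decorated by (1) being 1, each of them
    contributes the same product to [pnear y w]. *)
Lemma pnear_dicritical :
  pnear y w = (degree w)%:Z * \prod_(z in nbrs w :\ y) qnear w z.
Proof.
rewrite pnear_side_sum // /side_sum (big_setID (arrows0 T)) /= big1 ?add0r.
  rewrite (eq_bigr (fun=> \prod_(z in nbrs w :\ y) qnear w z)); last first.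
    move=> z /setDP[zB z0]; have [wz _ zA] := dicritical_nbr zB.
    have z1 : z \in arrows1 T by rewrite inE z0.
    rewrite pnear_arrow1 // mulr1 [RHS](big_setD1 z) //=.
    by have [_ ->] := dicritical_arrow1 z1 wz; rewrite mul1r.
  rewrite sumr_const -mulr_natl natz; congr (_%:Z * _); apply: eq_card => z.
  rewrite [RHS]inE; apply/setDP/andP => [[zB z0]|[z1 wz]].
    by have [wz _ zA] := dicritical_nbr zB; rewrite inE z0.
  by have [] := dicritical_arrow1 z1 wz; split=> //; case/setDP: z1.
by move=> z /setIP[/dicritical_nbr[wz _ _] z0]; rewrite pnear_arrow0 ?mulr0.
Qed.

(** The local identity at [w] reads 0 = A * (q d_w + [pnear w y]), where A > 0 is
    the product of the decorations at [w] away from [y]. *)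
Lemma pnear_dicritical_rev : pnear w y = - qnear w y * (degree w)%:Z.
Proof.
set A := \prod_(z in nbrs w :\ y) qnear w z.
have A_neq0 : A != 0.
  apply/prodf_neq0 => z /dicritical_nbr[wz lt_wz _].
  by rewrite gt_eqF // (lt_le_trans _ (qnear_ge1 wV wz lt_wz)).
have [_] := dicriticalP _ wD; rewrite (mult_edge wV (subN_vertex yN) wy).
rewrite bigQE // pnear_dicritical -/A => w0; apply: (mulfI A_neq0).
by apply/eqP; rewrite -subr_eq0 -w0; apply/eqP; ring.
Qed.

End Dicritical.

(** The (1)-arrows hang on dicritical vertices only, so they do not occur next to
    a vertex of positive multiplicity. *)
Lemma nbr_cases y z : y \in subN T -> adj y z ->
  [|| z \in arrows0 T, z \in subN T | z \in dicriticals T].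
Proof.
move=> yN yz; have [zA|zV] := boolP (z \in arrows T).
  have /orP[->//|z1] := arrow_cases zA.
  have [w wD wz] := mc_arrow1 hmin z1.
  have wy : w = y by apply: arrow_nbr zA _ _; rewrite adj_sym.
  have [_ w0] := dicriticalP _ wD; move: yN.
  by rewrite -wy inE w0 ltxx andbF.
have {}zV : z \in vertices T by rewrite inE.
have := mc_mult_ge0 hmin zV; rewrite le_eqVlt => /orP[/eqP z0|z_gt0].
  by apply/or3P/Or33/dicriticalP.
by apply/or3P/Or32/setIdP.
Qed.

(** * Divisibility by the characteristic numbers *)

(** The values of [pnear] out of [y] and back to [y] determine all data at [y]
    except [pnear y x]. Each neighbour [z] gives, by reading [pnear z y] at [y],
    that [pnear y x] times the decorations at [y] towards the neighbours other
    than [x] and [z] is a multiple of [g]; by coprimality only the dead end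
    survives. *)
Lemma multiples_step (g : rat) x y :
  adj x y -> x \in vertices T -> y \in subN T -> in_multiples g (dnum y)%:~R ->
  (forall z, z \in subN_nbrs y :\ x ->
     in_multiples g (pnear y z)%:~R /\ in_multiples g (pnear z y)%:~R) ->
  in_multiples g (pnear x y)%:~R /\
  in_multiples g ((dead_dec y)%:~R * (pnear y x)%:~R).
Proof.
move=> xy xV yN gd gz; have yV := subN_vertex yN.
have yx : adj y x by rewrite adj_sym.
(* Dicritical neighbours play the part of neighbours with c = d_w. *)
have gdeg w : w \in dic_adj y -> in_multiples g (degree w)%:Z%:~R.
  move=> wD; apply: in_multiples_trans gd _; apply: in_multiples_int.
  rewrite /dnum /is_node yN /=; case: eqVneq => [D0|_].
    by rewrite D0 inE in wD.
  by rewrite dvdzE /=; apply: (@biggcdn_inf _ w).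
have gdic w : w \in dicriticals T -> adj y w ->
    in_multiples g (pnear y w)%:~R /\ in_multiples g (pnear w y)%:~R.
  move=> wD yw; have gw : in_multiples g (degree w)%:Z%:~R.
    by apply: gdeg; rewrite inE wD.
  rewrite (pnear_dicritical yN wD yw) (pnear_dicritical_rev yN wD yw).
  rewrite !rmorphM /= [_%:Z%:~R * _]mulrC -!rmorphM /=.
  by split; rewrite rmorphM; apply: in_multiplesMz.
have gmult : in_multiples g (mult y)%:~R.
  have [D0|[w wD]] := set_0Vmem (dic_adj y).
    by move: gd; rewrite /dnum /is_node D0 eqxx andbF.
  move: (wD); rewrite inE => /andP[wDic yw]; have [g1 g2] := gdic w wDic yw.
  have [wV _] := dicriticalP _ wDic.
  rewrite (mult_edge yV wV yw) rmorphD !rmorphM.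
  by apply: in_multiplesD; apply: in_multiplesMz.
have gnbr z : z \in nbrs y :\ x ->
    in_multiples g (pnear y z)%:~R /\
    (z \in arrows0 T \/ z \in vertices T /\ in_multiples g (pnear z y)%:~R).
  rewrite in_setD1 => /andP[nzx]; rewrite inE => yz.
  have /or3P[z0|zN|zD] := nbr_cases yN yz.
  - by rewrite pnear_arrow0 //; split; [exact: in_multiples0 | left].
  - have [|g1 g2] := gz z; first by rewrite in_setD1 nzx inE zN.
    by split=> //; right; rewrite subN_vertex.
  - have [g1 g2] := gdic z zD yz; have [zV _] := dicriticalP _ zD.
    by split=> //; right.
have gside (B : {set T}) : B \subset nbrs y :\ x ->
    in_multiples g (side_sum y B)%:~R.
  move=> /subsetP sB; apply: in_multiples_sum => z /sB/gnbr[g1 _].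
  by rewrite rmorphM; apply: in_multiplesMz.
have gp : in_multiples g (pnear x y)%:~R by rewrite pnear_side_sum //; apply: gside.
split=> //; set C := (nbrs y :\ x) :\: arrows0 T.
have x0 : x \notin arrows0 T.
  by apply: contraTN xV => /setIdP[xA _]; rewrite inE negbK.
have prodE (Z : {set T}) : (forall z, z \in arrows0 T -> z \notin Z) ->
    \prod_(w in nbrs y :\ x :\: Z) qnear y w
    = (\prod_(w in C :\: Z) qnear y w) * dead_dec y.
  move=> Z0; rewrite dead_dec_prod // (big_setID (arrows0 T)) /= mulrC.
  congr (_ * _); apply: eq_bigl => w; first by rewrite !in_setD andbCA.
  rewrite !in_setI !in_setD in_set1; case: (boolP (w \in arrows0 T)) => w0.
    by rewrite Z0 // (_ : w != x) ?andbT //; apply: contraNneq x0 => <-.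
  by rewrite !andbF.
apply: (in_multiples_coprime (C := C) (f := qnear y)).
- move=> z1 z2 /setDP[/setD1P[_ +] _] /setDP[/setD1P[_ +] _] nz12.
  rewrite !inE => yz1 yz2; apply: (newton_coprime hT yV).
  + by rewrite inE -/(adj y z1) yz1 set21.
  + by rewrite inE -/(adj y z2) yz2 set21.
  + by apply: contra nz12 => /eqP/(pair_setI (adj_neq yz1))->.
(* No factor left out: this is the multiplicity of [y]. *)
- rewrite mulrA -rmorphM.
  have := prodE set0; rewrite !setD0 => <-; last by move=> z; rewrite in_set0.
  rewrite -rmorphM -bigQE //.
  have := mult_edge yV xV yx; move/(canLR (addKr _)) => <-.
  by rewrite addrC rmorphB rmorphM; apply: in_multiplesB => //; apply: in_multiplesMz.
(* The factor of [z] left out: this is [pnear z y], read at [y]. *)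
move=> z /setDP[zB z0]; have [_ [zA|[zV gzy]]] := gnbr z zB.
  by rewrite zA in z0.
have [nzx yz] := setD1P zB; rewrite inE in yz.
rewrite mulrA -rmorphM -prodE; last first.
  by move=> w w0; rewrite inE; apply: contraNneq z0 => <-.
move: gzy; rewrite pnear_side_sum 1?adj_sym // (@side_sum_rem _ y x); last first.
  by rewrite !inE eq_sym nzx.
have -> : nbrs y :\ z :\ x = nbrs y :\ x :\ z by rewrite !setDDl setUC.
move=> gsum; have gB := in_multiplesMz (qnear y x) (gside _ (subD1set _ z)).
have := in_multiplesB gsum gB.
by rewrite rmorphD !rmorphM addrAC subrr add0r.
Qed.

Lemma pairsP_pair x y : x \in subN T -> y \in subN T -> adj x y ->
  (x, [set x; y]) \in pairsP T.
Proof.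
move=> xN yN xy; rewrite inE /= xN set21 andbT inE -/(adj x y) xy /=.
by apply/subsetP => z /set2P[]->.
Qed.

Lemma multiples_charnum x y : adj x y -> x \in subN T -> y \in subN T ->
  in_multiples (charnum x [set x; y]) (pnear x y)%:~R /\
  in_multiples (charnum x [set x; y]) (pnear y x)%:~R.
Proof.
move: x y; apply: edge_ind => x y xy IHz xN yN; have yV := subN_vertex yN.
have a0 := dead_dec_neq0 yV.
have [g [-> gd gc]] : exists g, [/\ charnum x [set x; y] = g / (dead_dec y)%:~R,
    in_multiples g (dnum y)%:~R & forall z, z \in subN_nbrs y :\ x ->
    in_multiples g (charnum y [set y; z])].
  rewrite charnumE ?pairsP_pair // other_endE ?adj_neq //.
  case: eqP => [eps1|_].
    exists (dnum y)%:~R; split=> //; first by exists 1; rewrite mulr1.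
    have xB : x \in subN_nbrs y by rewrite inE xN adj_sym.
    move=> z; move: eps1; rewrite /epsilon (cardsD1 x) xB => -[/eqP].
    by rewrite cards_eq0 => /eqP->; rewrite inE.
  eexists; split; first by [].
    by apply: in_multiples_rat_gcd; rewrite inE eqxx.
  move=> z zB; apply: in_multiples_rat_gcd; rewrite inE; apply/orP; right.
  by apply/mapP; exists z; rewrite ?mem_enum.
have [|gp gp'] := multiples_step xy (subN_vertex xN) yN gd.
  move=> z zB; have := gc z zB; case/setD1P: zB => nzx; rewrite inE => /andP[zN yz].
  have [c1 c2] := IHz z yz nzx yN zN => gz.
  by split; [apply: in_multiples_trans c1 | apply: in_multiples_trans c2].
split; apply: in_multiples_div => //; exact: in_multiplesMz.
Qed.

End MinimallyComplete.
End NewtonTree.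

Theorem theorem3p16 (T : decorated_tree)
    (hT : newton_tree T) (hmin : minimally_complete T)
    (u : T) (e : {set T}) (hue : (u, e) \in pairsP T) :
  [/\ in_multiples (charnum u e) (pnum u e)%:~R,
      in_multiples (charnum u e) (pnum' u e)%:~R &
      in_multiples (charnum u e) (mult u)%:~R].
Proof.
have uN : u \in subN T by move: hue; rewrite inE => /and3P[].
have [eE /setIdP[yN uy]] := pairsP_other_end hue.
move: (other_end u e) eE yN uy => y -> yN uy.
have [cp cp'] := multiples_charnum hT hmin uy uN yN.
split; [exact: cp | by rewrite pnum'_pnear |].
rewrite (mult_edge (subN_vertex uN) (subN_vertex yN) uy) rmorphD !rmorphM.
by apply: in_multiplesD; apply: in_multiplesMz.
Qed.
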